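(* Let $m$ be a positive even integer and $k$ a positive odd integer with $\gcd(2^{k}-1,2^{m}-1)=1$ and $\gcd(2^{k}+1,2^{m}+1)=1$. Then the polynomial $$\sum_{1\le j\le 2^{k},\ j \equiv 0,2 \ (\mathrm{mod}\ 3)}x^{2^{k+m}-j2^{m}+j-1}$$ is a permutation polynomial over $\mathbb{F}_{2^{2m}}$.
   Context: A polynomial $f$ is a permutation polynomial over $\mathbb{F}_{q}$ if $x\mapsto f(x)$ is a bijection of $\mathbb{F}_q$. *)

(* Defs.v *)
From mathcomp Require Import all_boot all_order all_algebra.

Set Implicit Arguments.
Unset Strict Implicit.
Unset Printing Implicit Defensive.

Import GRing.Theory.
Local Open Scope ring_scope.

Definition permutation_polynomial (F : finFieldType) (f : {poly F}) : Prop :=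
  bijective (fun x : F => f.[x]).

(* Each index has 1 <= j <= 2 ^ k, so the truncated subtractions in the
   exponent are exact: it equals (2 ^ k - j) * 2 ^ m + (j - 1). *)
Definition residue_sum_poly (F : finFieldType) (m k : nat) : {poly F} :=
  \sum_(1 <= j < (2 ^ k).+1 | (j == 0 %[mod 3]) || (j == 2 %[mod 3]))
     'X^(2 ^ (k + m) - j * 2 ^ m + j - 1).

(* Main.v *)
Require Import Defs.
From mathcomp Require Import all_boot all_order all_algebra.
From mathcomp Require Import all_fingroup all_solvable all_field.
From mathcomp Require Import zify ring.

(** Write [q = 2 ^ m], [Q = 2 ^ k], let [f] be the polynomial and let [w] be a
    primitive cube root of unity, which lies in the subfield with [q] elements
    because [m] is even.  The additive map [L x = x ^ q + w x] is injective on
    the field with [q ^ 2] elements, and [L (f x) = L x ^ (Q - 1)]: both sides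
    expand into the sum of the monomials [w ^ i x ^ (q (Q - 1 - i) + i)] for
    [i < Q].  Since [Q - 1] is prime to [q ^ 2 - 1], the power map is injective,
    hence so is [f]. *)

(** Modulo a common divisor [d], both [2 ^ k] and [2 ^ (2 * m)] are 1. As [k] is odd, [k * m] is [m]
    plus a multiple of [2 * m], so [2 ^ m] is 1 as well and [d] divides a gcd known to be 1. *)
Lemma coprime_subn1_exp2 (k m : nat) :
  odd k -> coprime (2 ^ k - 1) (2 ^ m - 1) ->
  coprime (2 ^ k - 1) (2 ^ (2 * m) - 1).
Proof.
move=> k_odd co_km; set d := gcdn (2 ^ k - 1) (2 ^ (2 * m) - 1).
have two_k : 2 ^ k = 1 %[mod d].
  by apply/eqP; rewrite eqn_mod_dvd ?expn_gt0 // dvdn_gcdl.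
have two_2m : 2 ^ (2 * m) = 1 %[mod d].
  by apply/eqP; rewrite eqn_mod_dvd ?expn_gt0 // dvdn_gcdr.
have two_m : 2 ^ m = 1 %[mod d].
  have <- : (2 ^ k) ^ m = 1 %[mod d] by rewrite -modnXm two_k modnXm exp1n.
  have -> : (2 ^ k) ^ m = 2 ^ m * (2 ^ (2 * m)) ^ k./2.
    rewrite -!expnM -expnD -{1}(odd_double_half k) k_odd -muln2.
    by congr (2 ^ _) => /=; ring.
  by rewrite -[RHS]modnMmr -(modnXm k./2) two_2m modnXm exp1n modnMmr muln1.
have d_dvd : d %| 2 ^ m - 1 by rewrite -eqn_mod_dvd ?expn_gt0 //; apply/eqP.
by rewrite /coprime -/d -dvdn1 -(eqP co_km) dvdn_gcd d_dvd dvdn_gcdl.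
Qed.

Section FiniteFields.

Import GRing.Theory.
Local Open Scope ring_scope.

Lemma expf_inj_coprime (F : finFieldType) (n : nat) :
  (0 < n)%N -> coprime n #|F|.-1 -> injective (fun x : F => x ^+ n).
Proof.
move=> n_gt0 /eqP co_n; case: (egcdnP #|F|.-1 n_gt0) => a b def_a _.
rewrite co_n in def_a.
apply: (@can_inj _ _ _ (fun x => x ^+ a)) => x.
rewrite -exprM mulnC def_a.
(* Peeling off one factor [x ^+ #|F|.-1] at a time and using only [x ^+ #|F| = x] covers [x = 0]
   too. *)
elim: b {def_a} => [|b IHb]; first by rewrite expr1.
rewrite mulSn -addnA exprD IHb -exprSr prednK ?expf_card //.
by apply/card_gt0P; exists 0.
Qed.

Lemma finField_prim_root_prime (F : finFieldType) (p : nat) :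
  prime p -> (p %| #|F|.-1)%N -> exists w : F, p.-primitive_root w.
Proof.
move=> p_pr; rewrite -finalg.card_finField_unit.
case/(Cauchy (G := [set: {unit F}]%G) p_pr) => u _ ou.
exists (val u); apply/andP; split; first exact: prime_gt0.
apply/forallP => i; rewrite unity_rootE -FinRing.val_unitX.
rewrite -[1]/(val (1%g : {unit F})) val_eqE -order_dvdn ou.
apply/eqP; apply/idP/eqP => [/dvdn_leq|->//].
by move=> /(_ isT) le_p; apply/eqP; rewrite eqn_leq le_p ltn_ord.
Qed.

(** After multiplication by [a + b], the left side is [a ^+ Q + b ^+ Q] with [Q = 2 ^ k]; signs
    vanish in characteristic 2, so this is the factorization of a difference of powers. *)
Lemma exprD_pchar2_subn1 (R : fieldType) (k : nat) (a b : R) :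
  2 \in [pchar R] -> a + b != 0 ->
  (a + b) ^+ (2 ^ k - 1) = \sum_(i < 2 ^ k) a ^+ (2 ^ k - 1 - i) * b ^+ i.
Proof.
move=> char2 ab_n0; apply: (mulfI ab_n0).
rewrite -exprS subn1 prednK ?expn_gt0 //.
rewrite exprDn_pchar; last by rewrite (eq_pnat _ (pcharf_eq char2)) pnatX pnat_id.
have := subrXX a b (2 ^ k); rewrite !(oppr_pchar2 char2) => ->.
by congr (_ * _); apply: eq_bigr => i _; rewrite -subn1 -subnDA add1n.
Qed.

Section FrobeniusConjugate.

Variables (F : finFieldType) (m k : nat).
Hypotheses (m_even : ~~ odd m) (k_odd : odd k) (cardF : #|F| = (2 ^ (2 * m))%N).

Let char2 : 2 \in [pchar F].
Proof. exact: card_finPcharP cardF isT. Qed.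

Let q_pnat : [pchar F].-nat (2 ^ m)%N.
Proof. by rewrite (eq_pnat _ (pcharf_eq char2)) pnatX pnat_id. Qed.

Lemma expq_involutive (x : F) : (x ^+ (2 ^ m)) ^+ (2 ^ m) = x.
Proof. by rewrite -exprM -expnD addnn -mul2n -cardF expf_card. Qed.

Lemma horner_residue_sum_poly (x : F) :
  (residue_sum_poly F m k).[x] =
  \sum_(i < 2 ^ k | ~~ (3 %| i)%N) (x ^+ (2 ^ m)) ^+ (2 ^ k - 1 - i) * x ^+ i.
Proof.
rewrite /residue_sum_poly horner_sum big_add1 /= big_mkord.
(* With [j = i + 1], the classes 0 and 2 of [j] modulo 3 become the classes 2 and 1 of [i]. *)
apply: eq_big => [i|i _]; first by lia.
rewrite hornerXn -exprM -exprD expnD -mulnBl addnS subn1 /= mulnC.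
by rewrite -subnDA add1n.
Qed.

(** Raising to the power [2 ^ m] swaps [x] and its conjugate, hence reverses the index. Since
    [2 ^ k] is 2 modulo 3, the condition on [i] turns from [i] not 0 into [i] not 1 modulo 3. The
    classes 0, 1, 2 thus receive the coefficients 1, [w], [1 + w], which are the powers [w ^+ i]. *)
Lemma frobenius_twist_residue_sum (w x : F) :
  3.-primitive_root w ->
  (residue_sum_poly F m k).[x] ^+ (2 ^ m) + w * (residue_sum_poly F m k).[x] =
  \sum_(i < 2 ^ k) (x ^+ (2 ^ m)) ^+ (2 ^ k - 1 - i) * (w * x) ^+ i.
Proof.
move=> w_prim; rewrite horner_residue_sum_poly.
set y := x ^+ (2 ^ m).
have -> : (\sum_(i < 2 ^ k | ~~ (3 %| i)%N) y ^+ (2 ^ k - 1 - i) * x ^+ i)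
            ^+ (2 ^ m) =
          \sum_(i < 2 ^ k | ~~ (3 %| 2 ^ k - 1 - i)%N)
             y ^+ (2 ^ k - 1 - i) * x ^+ i.
  rewrite (big_morph (fun z : F => z ^+ (2 ^ m)) (id1 := 0) (op1 := +%R)).
  - rewrite (reindex_inj rev_ord_inj) /=.
    apply: eq_big => [i|i _]; first by congr (~~ (3 %| _)%N); lia.
    rewrite exprMn -!exprM ![(_ * 2 ^ m)%N]mulnC !exprM expq_involutive -/y.
    rewrite mulrC; congr (y ^+ _ * x ^+ _); have := ltn_ord i; lia.
  - by move=> a b; rewrite exprDn_pchar.
  - by rewrite expr0n expn_eq0.
have Q_mod3 : (2 ^ k %% 3 = 2)%N.
  rewrite -(odd_double_half k) k_odd -mul2n expnD expnM -modnMmr -modnXm.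
  by rewrite exp1n.
have w_sum : 1 + w = w ^+ 2.
  have w_n1 : w - 1 != 0.
    by rewrite subr_eq0 -(expr1 w) -(prim_order_dvd w_prim).
  have /eqP := prim_expr_order w_prim.
  rewrite -subr_eq0 subrX1 mulf_eq0 (negPf w_n1) /=.
  rewrite !big_ord_recr big_ord0 /= add0r expr0 expr1 addr_eq0.
  by rewrite oppr_pchar2 // => /eqP.
rewrite mulr_sumr big_mkcond [X in _ + X]big_mkcond -big_split /=.
apply: eq_bigr => i _.
rewrite exprMn -(prim_expr_mod w_prim).
have -> : (3 %| 2 ^ k - 1 - i)%N = (i %% 3 == 1)%N by have := ltn_ord i; lia.
rewrite /dvdn; have := ltn_pmod i (isT : (0 < 3)%N).
case: (i %% 3)%N => [|[|[|//]]] _ /=.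
- by rewrite expr0 addr0 mul1r.
- by rewrite expr1 add0r; ring.
- by rewrite -w_sum; ring.
Qed.

Lemma frobenius_twist_eq0 (w x : F) :
  3.-primitive_root w -> (x ^+ (2 ^ m) + w * x == 0) = (x == 0).
Proof.
move=> w_prim; apply/eqP/eqP => [/eqP|->]; last first.
  by rewrite expr0n expn_eq0 mulr0 addr0.
rewrite addr_eq0 oppr_pchar2 // => /eqP xq.
(* As [m] is even, [2 ^ m] is a power of 4, hence 1 modulo 3. Conjugating [x ^+ (2 ^ m) = w * x]
   then gives [x = w ^+ 2 * x]. *)
have wq : w ^+ (2 ^ m) = w.
  rewrite -(prim_expr_mod w_prim) -(odd_double_half m) (negPf m_even) -mul2n.
  by rewrite add0n expnM -modnXm exp1n expr1.
have := expq_involutive x; rewrite xq exprMn wq xq mulrA => /eqP.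
rewrite -subr_eq0 -{2}(mul1r x) -mulrBl mulf_eq0 subr_eq0.
by rewrite -expr2 -(prim_order_dvd w_prim) => /eqP.
Qed.

Lemma frobenius_twist_inj (w : F) :
  3.-primitive_root w -> injective (fun x : F => x ^+ (2 ^ m) + w * x).
Proof.
move=> w_prim x y /eqP; rewrite -subr_eq0.
have -> : x ^+ (2 ^ m) + w * x - (y ^+ (2 ^ m) + w * y) =
          (x - y) ^+ (2 ^ m) + w * (x - y).
  by rewrite !(oppr_pchar2 char2) exprDn_pchar //; ring.
by rewrite frobenius_twist_eq0 // subr_eq0 => /eqP.
Qed.

End FrobeniusConjugate.

End FiniteFields.

Theorem theorem5 (m k : nat) (F : finFieldType)
  (m_gt0 : 0 < m) (m_even : ~~ odd m)
  (k_gt0 : 0 < k) (k_odd : odd k)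
  (gcd_minus : gcdn (2 ^ k - 1) (2 ^ m - 1) = 1)
  (gcd_plus : gcdn (2 ^ k + 1) (2 ^ m + 1) = 1)
  (cardF : #|F| = 2 ^ (2 * m)) :
  permutation_polynomial (residue_sum_poly F m k).
Proof.
have char2 : 2 \in [pchar F]%R by exact: card_finPcharP cardF isT.
have [w w_prim] : exists w : F, (3.-primitive_root w)%R.
  apply: finField_prim_root_prime => //.
  by rewrite cardF -subn1 -eqn_mod_dvd ?expn_gt0 // expnM -modnXm exp1n.
have Q1_gt0 : (0 < 2 ^ k - 1)%N by rewrite subn_gt0 -(expn0 2) ltn_exp2l.
have twist x : ((residue_sum_poly F m k).[x] ^+ (2 ^ m)
                 + w * (residue_sum_poly F m k).[x] =
               (x ^+ (2 ^ m) + w * x) ^+ (2 ^ k - 1))%R.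
  rewrite frobenius_twist_residue_sum //.
  (* The expansion cancels the twist of [x], which is nonzero only for [x != 0]. At 0, every term
     has total degree [2 ^ k - 1 > 0], so both sides vanish. *)
  have [->|x_n0] := eqVneq x 0%R; last first.
    by rewrite exprD_pchar2_subn1 // frobenius_twist_eq0.
  rewrite GRing.mulr0 GRing.expr0n expn_eq0 GRing.addr0 GRing.expr0n.
  rewrite (gtn_eqF Q1_gt0).
  apply: big1 => i _; rewrite -GRing.exprD GRing.expr0n.
  by have := ltn_ord i; case: eqP => //; lia.
apply: injF_bij => x y fxy.
apply: (frobenius_twist_inj _ _ m_even cardF _ w_prim).
apply: (expf_inj_coprime _ (2 ^ k - 1)) => //=.
  by rewrite cardF -subn1 coprime_subn1_exp2 //; apply/eqP.
by rewrite -!twist fxy.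
Qed.
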